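(* Let $G$ be a claw-free cubic graph with $n$ vertices and with no cutedge. Then $G$ has more than $2^{n/12}$ perfect matchings.
   Context: Graphs are finite, nonempty and simple (no loops and no parallel edges); $G$ is not assumed to be connected. A graph is claw-free if it has no induced subgraph isomorphic to $K_{1,3}$. A graph is cubic if every vertex has exactly three incident edges. A cutedge (bridge) is an edge whose deletion increases the number of connected components. A perfect matching is a set of edges such that every vertex is incident with exactly one edge of the set. *)

(* Defs.v *)
From mathcomp Require Import all_boot all_order all_algebra.
From mathcomp Require Import reals exp.
Set Implicit Arguments.
Unset Strict Implicit.
Unset Printing Implicit Defensive.

(* A finite simple graph is a symmetric irreflexive adjacency relation e on a
   finType of vertices.  An edge is the two-element set of its ends. *)

Definition edges (T : finType) (e : rel T) : {set {set T}} :=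
  [set [set p.1; p.2] | p : T * T & e p.1 p.2].

Definition incident (T : finType) (E : {set {set T}}) (v : T) : {set {set T}} :=
  [set A in E | v \in A].

Definition cubic (T : finType) (e : rel T) : Prop :=
  forall v : T, #|incident (edges e) v| = 3.

(* An induced subgraph of e isomorphic to h amounts to an injection of the
   vertices of h that preserves and reflects adjacency. *)
Definition has_induced_copy (S T : finType) (h : rel S) (e : rel T) : Prop :=
  exists f : S -> T, injective f /\ forall x y, e (f x) (f y) = h x y.

Definition complete_bipartite (m n : nat) : rel ('I_m + 'I_n)%type :=
  fun x y => match x, y with
             | inl _, inr _ | inr _, inl _ => true
             | _, _ => false
             end.

Definition claw_free (T : finType) (e : rel T) : Prop :=
  ~ has_induced_copy (@complete_bipartite 1 3) e.

Definition delete_edge (T : finType) (e : rel T) (A : {set T}) : rel T :=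
  fun x y => e x y && ([set x; y] != A).

Definition components (T : finType) (e : rel T) : nat := n_comp e [set: T].

Definition cutedge (T : finType) (e : rel T) (A : {set T}) : Prop :=
  A \in edges e /\ components e < components (delete_edge e A).

Definition perfect_matching (T : finType) (e : rel T) (M : {set {set T}}) : bool :=
  (M \subset edges e) && [forall v, #|incident M v| == 1].

Definition perfect_matchings (T : finType) (e : rel T) : {set {set {set T}}} :=
  [set M | perfect_matching e M].

(* Main.v *)
Require Import Defs.
From mathcomp Require Import all_boot all_order all_algebra.
From mathcomp Require Import reals exp.
From mathcomp Require Import zify.
Set Implicit Arguments.
Unset Strict Implicit.
Unset Printing Implicit Defensive.

(** The vertices of a claw-free cubic graph fall into blocks, the classes of
the relation generated by the edges that lie in a triangle.  A vertex has only
three neighbours, so a block is either a triangle or a diamond with vertices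
a, b, c, d, in which all pairs but possibly a d are adjacent (if a d is an edge
too, the block is a component K_4).  Each vertex has at most one neighbour
outside its block ([exists_block_partition], [outside_le1]).

Let B be the set of edges between blocks, and cut P the set of those with an
end in the block P.  If M is a perfect matching, then C = B \ M meets every
cut in an even number of edges, since #|cut P| and #|P| have the same parity.
Conversely, let C be any even set, one meeting every cut in an even number of
edges, and match the ends of the edges of B \ C along these edges.  Inside each
block an even number of vertices remain.  They can be matched in at least one
way, and in two ways if the block is a diamond that remains whole, that is, if
cut P is contained in C.  Hence #PM is at least the sum over the even sets C of
2 ^ f(C), where f(C) counts these free diamonds ([sum_free_diamonds_le]).

Let there be t triangles and q diamonds, and let N be the number of even sets.
- A triangle block has a cut of size 3 and a diamond block one of size 0 or 2.
  Even sets are the solutions of one linear equation over F_2 per nonempty cut,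
  so N ^ 2 >= 2 ^ t ([card_even_sets_ge], [card_between_blocks]).
- Since no edge of B is a cutedge, it lies on a cycle, whose edges in B form an
  even set.  Adding that set modulo 2 shows that the edge lies in exactly half
  of the even sets.  So each diamond is free for at least half of the even
  sets, and f has average at least q / 2 ([card_free_ge]).
- By convexity of 2 ^ x, the sum of 2 ^ f(C) is at least N * 2 ^ (q / 2)
  ([sum_exp2_ge]).

Thus #PM ^ 2 >= 2 ^ (t + q), whereas n = 3 t + 4 q <= 4 (t + q), so that
#PM >= 2 ^ (n / 8) > 2 ^ (n / 12). *)

(** * A convexity inequality *)

(** The tangent line inequality 2 ^ f >= 2 ^ a (1 + f - a), valid for all
integers f, in a form without subtraction. *)
Lemma exp2_tangent a f : 2 ^ a * f.+1 <= 2 ^ f + 2 ^ a * a.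
Proof.
have [le_af|lt_fa] := leqP a f; last first.
  by apply: leq_trans (leq_addl _ _); rewrite leq_mul2l lt_fa orbT.
rewrite -(subnK le_af) expnD -addnS mulnDr addnC [2 ^ (f - a) * _]mulnC.
have : f - a < 2 ^ (f - a) by apply: ltn_expl.
nia.
Qed.

(** Convexity: if f is q / 2 on average, then 2 ^ f is 2 ^ (q / 2) on average.
Squaring both sides keeps the inequality in the natural numbers. *)
Lemma sum_exp2_ge (I : finType) (X : {set I}) (f : I -> nat) (q : nat) :
  #|X| * q <= 2 * \sum_(i in X) f i ->
  #|X| ^ 2 * 2 ^ q <= (\sum_(i in X) 2 ^ f i) ^ 2.
Proof.
(* For odd q the average q / 2 is not an integer, and the tangent at
   a = (q - 1) / 2 gives a factor 3 / 2 in place of the square root of 2. *)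
move=> le_q; set a := q./2; set S := \sum_(i in X) 2 ^ f i.
have tangent : 2 ^ a * (#|X| + \sum_(i in X) f i) <= S + 2 ^ a * a * #|X|.
  rewrite -sum1_card -big_split big_distrr /=.
  rewrite big_distrr -big_split /=; apply: leq_sum => i _.
  by rewrite muln1; apply: exp2_tangent.
have defq : q = odd q + a.*2 by rewrite odd_double_half.
rewrite defq expnD -muln2 expnM in le_q *.
move: tangent le_q; set s := \sum_(i in X) f i; set p := 2 ^ a; set N := #|X|.
move=> tangent le_q.
have {tangent le_q} : N * p * (2 + odd q) <= 2 * S.
  by case: (odd q) le_q => /= le_q; nia.
case: (odd q) => /= le_S; rewrite ?expn1 ?expn0.
  have : (N * p * 3) ^ 2 <= (2 * S) ^ 2 by rewrite leq_exp2r.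
  by rewrite !expnMn; lia.
have : N * p <= S by lia.
by rewrite -(leq_exp2r _ _ (isT : 0 < 2)) expnMn mul1n.
Qed.

(** * Sets that meet prescribed cuts evenly *)

Section SymmetricDifference.
Variable E : finType.
Implicit Types (C D S : {set E}).

Definition symd C D : {set E} := [set x | (x \in C) (+) (x \in D)].

Lemma symdK C : involutive (symd C).
Proof. by move=> D; apply/setP => x; rewrite !inE addbA addbb. Qed.

Lemma symd_subset C D S : C \subset S -> D \subset S -> symd C D \subset S.
Proof.
move=> /subsetP CS /subsetP DS; apply/subsetP => x; rewrite inE.
by have [/CS//|_ /=] := boolP (x \in C); apply: DS.
Qed.

Lemma odd_symd C D S :
  odd #|symd C D :&: S| = odd #|C :&: S| (+) odd #|D :&: S|.
Proof.
have cardE (F : {set E}) : #|F :&: S| = \sum_(x in S) (x \in F).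
  rewrite -sum1_card big_mkcond [RHS]big_mkcond; apply: eq_bigr => x _.
  by rewrite inE; case: (x \in F); case: (x \in S).
rewrite !cardE -oddD -big_split /=.
rewrite !(big_morph odd oddD (erefl : odd 0 = false)).
by apply: eq_bigr => x _; rewrite inE oddD !oddb.
Qed.

Variables (K : finType) (cut : K -> {set E}) (B : {set E}) (I : {set K}).

Definition even_sets : {set {set E}} :=
  [set C : {set E} | (C \subset B) && [forall k in I, ~~ odd #|C :&: cut k|]].

Lemma even_setsP C : reflect
  (C \subset B /\ forall k, k \in I -> ~~ odd #|C :&: cut k|) (C \in even_sets).
Proof.
rewrite inE; apply: (iffP andP) => -[CB].
  by move/forall_inP.
by move=> /forall_inP.
Qed.

Lemma even_sets_symd C D :
  C \in even_sets -> D \in even_sets -> symd C D \in even_sets.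
Proof.
move=> /even_setsP[CB evC] /even_setsP[DB evD]; apply/even_setsP.
split=> [|k kI]; first exact: symd_subset.
by rewrite odd_symd (negPf (evC k kI)) evD.
Qed.

(** The even sets are the kernel of a linear map over F_2, with one coordinate
for each nonempty cut.  Adding a fixed member of a fibre embeds that fibre into
the kernel, so no fibre is larger than the kernel. *)
Lemma card_even_sets_ge :
  2 ^ #|B| <= #|even_sets| * 2 ^ #|[set k in I | cut k != set0]|.
Proof.
set I' := [set k in I | _].
pose syndrome (C : {set E}) := [set k in I | odd #|C :&: cut k|].
rewrite -!card_powerset.
rewrite -[leqLHS]sum1_card.
rewrite (partition_big syndrome (mem (powerset I'))) /=; last first.
  move=> C _; rewrite inE; apply/subsetP => k; rewrite !inE => /andP[-> /=].
  by apply: contraTneq => ->; rewrite setI0 cards0.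
rewrite mulnC -sum_nat_const; apply: leq_sum => S _; rewrite sum1dep_card.
set fiber := [set C | _].
have [->|[C0 C0f]] := set_0Vmem fiber; first by rewrite cards0.
rewrite -(card_imset _ (can_inj (symdK C0))); apply: subset_leq_card.
apply/subsetP => _ /imsetP[C Cf ->]; move: C0f Cf.
rewrite !inE => /andP[C0B /eqP defS] /andP[CB /eqP defS'].
rewrite symd_subset //; apply/forall_inP => k kI.
have /setP/(_ k) : syndrome C = syndrome C0 by rewrite defS'.
by rewrite odd_symd !inE kI /= => ->; rewrite addbb.
Qed.

(** Adding C0 modulo 2 exchanges the even sets that contain A with those that
do not. *)
Lemma card_even_sets_mem A C0 : C0 \in even_sets -> A \in C0 ->
  2 * #|[set C in even_sets | A \in (C : {set E})]| = #|even_sets|.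
Proof.
move=> C0ev AC0.
rewrite -(cardsID [set C : {set E} | A \in C] even_sets) mul2n -addnn.
congr (_ + _); first by apply: eq_card => C; rewrite !inE.
rewrite -(card_imset (mem [set C in even_sets | A \in (C : {set E})])
  (can_inj (symdK C0))); apply: eq_card => C.
apply/idP/setDP => [/imsetP[D]|[Cev]].
  rewrite [_ \in mem _]inE inE => /andP[Dev AD] ->.
  by split; [exact: even_sets_symd|rewrite !inE AD AC0].
rewrite inE => AC; apply/imsetP; exists (symd C0 C); last by rewrite symdK.
by rewrite inE even_sets_symd //= inE AC0 (negPf AC).
Qed.

End SymmetricDifference.

(** * Edges, neighbours and cutedges *)

Lemma card_set2I (T : finType) (x y : T) (P : {set T}) :
  x != y -> #|[set x; y] :&: P| = (x \in P) + (y \in P).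
Proof.
move=> xy; rewrite -sum1_card.
rewrite (eq_bigl (fun z => (z \in [set x; y]) && (z \in P))).
  rewrite big_mkcondr /= big_setU1 ?inE //= big_set1.
  by case: (x \in P); case: (y \in P).
by move=> z; rewrite inE.
Qed.

Section Graph.
Variables (T : finType) (e : rel T).
Hypotheses (e_sym : symmetric e) (e_irr : irreflexive e).
Implicit Types (u v w x y z : T) (A D P U : {set T}) (C J m : {set {set T}}).

Lemma adj_neq x y : e x y -> x != y.
Proof. by apply: contraTneq => ->; rewrite e_irr. Qed.

Lemma edgesP A :
  reflect (exists x y, e x y /\ A = [set x; y]) (A \in edges e).
Proof.
apply: (iffP imsetP) => [[[x y] + ->]|[x [y [exy ->]]]].
  by rewrite inE /= => exy; exists x, y.
by exists (x, y); rewrite ?inE.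
Qed.

Lemma set2_inj_r x y z : [set x; y] = [set x; z] -> y = z.
Proof.
move=> eq2; have: y \in [set x; z] by rewrite -eq2 set22.
have: z \in [set x; y] by rewrite eq2 set22.
by rewrite !inE => /orP[]/eqP-> // /orP[]/eqP->.
Qed.

Lemma mem_edges x y : ([set x; y] \in edges e) = e x y.
Proof.
apply/edgesP/idP => [[a [b [eab eq2]]]|exy]; last by exists x, y.
have : a \in [set x; y] by rewrite eq2 set21.
rewrite !inE => /orP[]/eqP ea; subst a.
  by rewrite (set2_inj_r eq2).
by rewrite e_sym; move: eq2; rewrite setUC => /set2_inj_r ->.
Qed.

Lemma edge_at A v : A \in edges e -> v \in A ->
  exists2 u, e v u & A = [set v; u].
Proof.
case/edgesP=> x [y [exy ->]]; rewrite !inE => /orP[]/eqP->; first by exists y.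
by exists x; rewrite 1?setUC // e_sym.
Qed.

Lemma card_incident J v : J \subset edges e ->
  #|incident J v| = #|[set u | [set v; u] \in J]|.
Proof.
move/subsetP=> JE; rewrite -(card_imset _ (@set2_inj_r v)).
apply: eq_card => A; apply/idP/imsetP => [|[u + ->]]; rewrite inE.
  case/andP=> AJ vA; have [u _ defA] := edge_at (JE A AJ) vA.
  by exists u; rewrite // inE -defA.
by rewrite inE => ->; rewrite set21.
Qed.

Lemma card_edgeI A P : A \in edges e -> #|A :&: P| <= 2.
Proof.
case/edgesP=> x [y [/adj_neq xy ->]]; rewrite card_set2I //.
by case: (x \in P); case: (y \in P).
Qed.

(** If the ends x and y were disconnected by the deletion, then mapping each
root of the smaller graph to the root of its component in e would be onto but
not injective, because x and y have the same image. *)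
Lemma connect_delete x y : e x y -> ~ cutedge e [set x; y] ->
  connect (delete_edge e [set x; y]) x y.
Proof.
move=> exy no_cut; set e' := delete_edge e _; apply/negPn/negP => ncxy.
apply: no_cut; split; first by rewrite mem_edges.
have sub_e' : subrel e' e by move=> u v /andP[].
have sym_e : connect_sym e by apply: sym_connect_sym.
have sym_e' : connect_sym e'.
  by apply: sym_connect_sym => u v; rewrite /e' /delete_edge e_sym setUC.
have cee' u v : connect e' u v -> connect e u v.
  by apply: connect_sub => a b /sub_e'/connect1.
rewrite /components.
have imR : [predI fingraph.roots e & [set: T]] \subset
      fingraph.root e @: [set r in fingraph.roots e'].
  apply/subsetP => r; rewrite !inE andbT => /eqP rr.
  apply/imsetP; exists (fingraph.root e' r).
    by rewrite !inE; apply: fingraph.roots_root.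
  rewrite -[LHS]rr; apply/eqP; rewrite (root_connect sym_e).
  by apply/cee'/connect_root.
apply: leq_ltn_trans (subset_leq_card imR) _.
have -> : n_comp_mem e' (mem [set: T]) = #|[set r in fingraph.roots e']|.
  by apply: eq_card => r; rewrite !inE andbT.
rewrite ltn_neqAle leq_imset_card andbT; apply/negP => /imset_injP inj.
move/negP: ncxy; apply; rewrite -(root_connect sym_e'); apply/eqP.
apply: inj; rewrite ?inE; try exact: fingraph.roots_root.
have rte z : fingraph.root e (fingraph.root e' z) = fingraph.root e z.
  by apply/esym/eqP; rewrite (root_connect sym_e); apply/cee'/connect_root.
by rewrite !rte; apply/eqP; rewrite (root_connect sym_e) connect1.
Qed.

Hypotheses (e_claw_free : claw_free e) (e_cubic : cubic e).

Definition nbrs v : {set T} := [set u | e v u].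

Lemma card_nbrs v : #|nbrs v| = 3.
Proof.
rewrite -[RHS](e_cubic v) card_incident //.
by apply: eq_card => u; rewrite !inE mem_edges.
Qed.

Lemma in_nbrs u v : (u \in nbrs v) = e v u. Proof. by rewrite inE. Qed.

Lemma nbrs_eq v s : uniq s -> size s = 3 -> all (e v) s -> nbrs v =i s.
Proof.
move=> s_uniq s3 vs u; suff -> : nbrs v = [set x in s] by rewrite inE.
apply/esym/eqP; rewrite eqEcard card_nbrs cardsE (card_uniqP s_uniq) s3 leqnn.
by rewrite andbT; apply/subsetP => x; rewrite !inE => /(allP vs).
Qed.

Lemma exists_triangle v : exists u w, [/\ e v u, e v w & e u w].
Proof.
have [/exists_inP[u vu /exists_inP[w vw uw]]|indep] :=
  boolP [exists u in nbrs v, exists w in nbrs v, e u w].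
  by exists u, w; split; rewrite // -in_nbrs.
case: e_claw_free.
have nE : size (enum (nbrs v)) = 3 by rewrite -cardE card_nbrs.
pose f (x : 'I_1 + 'I_3) := if x is inr i then nth v (enum (nbrs v)) i else v.
have fN i : e v (f (inr i)) by rewrite -in_nbrs -mem_enum mem_nth // nE.
exists f; split=> [[i|i] [j|j] /= fij|[i|i] [j|j]].
- by rewrite !ord1.
- by have := fN j; rewrite /= -fij e_irr.
- by have := fN i; rewrite /= fij e_irr.
- congr (inr _); apply/val_inj/eqP.
  by rewrite -(nth_uniq v _ _ (enum_uniq (nbrs v))) ?nE ?ltn_ord //; apply/eqP.
- exact: e_irr.
- exact: fN.
- by rewrite e_sym fN.
apply: contraNF indep => fij; apply/exists_inP; exists (f (inr i)).
  by rewrite in_nbrs.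
by apply/exists_inP; exists (f (inr j)); rewrite ?in_nbrs.
Qed.

(** * Triangle and diamond blocks *)

Definition triangle P := #|P| = 3 /\ {in P &, forall u v, u != v -> e u v}.

(** The adjacency of a and d is left open, so that K_4 is a diamond as well. *)
Definition is_diamond P a b c d :=
  [/\ P =i [:: a; b; c; d], uniq [:: a; b; c; d]
    & [/\ e a b, e a c, e b c, e b d & e c d]].

Definition diamond P := exists a b c d, is_diamond P a b c d.

Lemma sum_diamond P a b c d (F : T -> nat) : is_diamond P a b c d ->
  \sum_(v in P) F v = F a + F b + F c + F d.
Proof.
case=> defP abcd _; rewrite (eq_bigl _ _ defP) -big_uniq //=.
by rewrite !big_cons big_nil addn0 !addnA.
Qed.

(** The edges that lie in a triangle; the blocks are the classes that they
generate. *)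
Definition tri_adj : rel T := fun u v => e u v && [exists w, e u w && e v w].

Lemma tri_adj_sym : symmetric tri_adj.
Proof.
move=> u v; rewrite /tri_adj e_sym; congr (_ && _).
by apply: eq_existsb => w; rewrite andbC.
Qed.

Lemma tri_adjI u v w : e u v -> e u w -> e v w -> tri_adj u v.
Proof.
by move=> uv uw vw; rewrite /tri_adj uv; apply/existsP; exists w; rewrite uw.
Qed.

Definition block v : {set T} := [set u | connect tri_adj v u].

Lemma block_eq v P :
    (forall x y, tri_adj x y -> x \in P -> y \in P) -> v \in P ->
    (forall u, u \in P -> connect tri_adj v u) ->
  block v = P.
Proof.
move=> closedP vP conP; apply/setP => u; rewrite inE.
apply/idP/idP => [|/conP//].
have tsym := sym_connect_sym tri_adj_sym.
by move/(closed_connect (intro_closed tsym closedP)) => <-.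
Qed.

(** A diamond is a whole block: the neighbours of b and c lie in it, and a
common neighbour of a (or d) and an outside vertex adjacent to it would have to
be b or c. *)
Lemma block_diamond v P : diamond P -> v \in P -> block v = P.
Proof.
move=> [a [b [c [d [defP abcd [ab ac bc bd cd]]]]]] vP.
have [ba ca cb db dc] : [/\ e b a, e c a, e c b, e d b & e d c].
  by split; rewrite e_sym.
have PE x : x \in P = [|| x == a, x == b, x == c | x == d].
  by rewrite defP !inE.
have nb x : e b x -> x \in P.
  rewrite -in_nbrs (@nbrs_eq b [:: a; c; d]) ?PE ?inE /= ?ba ?bc ?bd //.
    by case/or3P => ->; rewrite ?orbT.
  move: abcd; rewrite /= !inE !negb_or.
  move=> /and4P[/and3P[n1 n2 n3] /andP[n4 n5] n6 _].
  by rewrite ?n1 ?n2 ?n3 ?n4 ?n5 ?n6.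
have nc x : e c x -> x \in P.
  rewrite -in_nbrs (@nbrs_eq c [:: a; b; d]) ?PE ?inE /= ?ca ?cb ?cd //.
    by case/or3P => ->; rewrite ?orbT.
  move: abcd; rewrite /= !inE !negb_or.
  move=> /and4P[/and3P[n1 n2 n3] /andP[n4 n5] n6 _].
  by rewrite ?n1 ?n2 ?n3 ?n4 ?n5 ?n6.
have end_closed p q : e p b -> e p c -> tri_adj p q -> q \in P.
  move=> pb pc /andP[pq /existsP[w /andP[pw qw]]]; apply/negPn/negP => qP.
  have qNb : q != b by apply: contraNneq qP => ->; rewrite PE eqxx orbT.
  have qNc : q != c by apply: contraNneq qP => ->; rewrite PE eqxx !orbT.
  have := pw; rewrite -in_nbrs.
  rewrite (@nbrs_eq p [:: b; c; q]) ?inE /= ?pb ?pc ?pq //; last first.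
    by rewrite !inE negb_or (adj_neq bc) eq_sym qNb eq_sym qNc.
  case/or3P=> /eqP defw; subst w; last by rewrite e_irr in qw.
    by rewrite nb ?(e_sym b) in qP.
  by rewrite nc ?(e_sym c) in qP.
apply: block_eq => // [p q pq|u].
  rewrite PE => /or4P[] /eqP ?; subst p.
  - exact: end_closed pq.
  - by apply: nb; case/andP: pq.
  - by apply: nc; case/andP: pq.
  - exact: end_closed pq.
have tsym := sym_connect_sym tri_adj_sym.
have conb x : x \in P -> connect tri_adj x b.
  rewrite PE => /or4P[]/eqP->; rewrite ?connect0 //; apply: connect1.
  - exact: (tri_adjI ab ac bc).
  - by apply: (tri_adjI cb ca); rewrite e_sym.
  - exact: (tri_adjI db dc bc).
by move=> uP; apply: connect_trans (conb v vP) _; rewrite tsym; apply: conb.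
Qed.

(** If no outside vertex sees two vertices of the triangle P, then no edge
leaving P lies in a triangle: the third vertex would be a neighbour of the end
in P, hence one of the other two vertices of P. *)
Lemma block_triangle v P : triangle P -> v \in P ->
  (forall x y z, x \in P -> y \in P -> x != y -> z \notin P ->
     e z x -> ~~ e z y) ->
  block v = P.
Proof.
move=> [P3 Pclique] vP noz; apply: block_eq => // [p q|u uP].
  move=> /andP[pq /existsP[w /andP[pw qw]]] pP; apply/negPn/negP => qP.
  have defN : nbrs p = q |: P :\ p.
    apply/esym/eqP; rewrite eqEcard card_nbrs cardsU1 !inE (negPf qP) andbF.
    rewrite (cardsD1 p) pP add1n in P3; rewrite add1n P3 leqnn andbT.
    apply/subsetP => x; rewrite !inE => /orP[/eqP->//|/andP[xp xP]].
    by rewrite Pclique // eq_sym.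
  have := pw; rewrite -in_nbrs defN !inE => /orP[/eqP wq|/andP[wp wP]].
    by rewrite wq e_irr in qw.
  have := noz p w q pP wP; rewrite eq_sym wp qP e_sym pq qw.
  by move/(_ isT isT isT).
have [->|vu] := eqVneq v u; first exact: connect0.
have : 0 < #|P :\ v :\ u|.
  move: P3; rewrite (cardsD1 v) vP (cardsD1 u (P :\ v)) !inE uP eq_sym vu /=.
  by rewrite !add1n => -[->].
case/card_gt0P=> w; rewrite !inE => /and3P[wu wv wP].
by apply/connect1/(@tri_adjI _ _ w); apply: Pclique; rewrite // eq_sym.
Qed.

(** A triangle through v either is a block, or some outside vertex z sees two
of its vertices x and y, and then z, x, y and the third vertex d form a
diamond. *)
Lemma block_cases v : triangle (block v) \/ diamond (block v).
Proof.
have [u [w [vu vw uw]]] := exists_triangle v.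
set P := [set v; u; w].
have vP : v \in P by rewrite !inE eqxx.
have PE x : x \in P = [|| x == v, x == u | x == w] by rewrite !inE orbA.
have Ptri : triangle P.
  split=> [|x y].
    by rewrite /P -setUA !cardsU1 cards1 !inE negb_or !adj_neq.
  rewrite !PE => /or3P[]/eqP-> /or3P[]/eqP->; rewrite ?eqxx // => _;
  by rewrite ?(e_sym u v) ?(e_sym w).
have [/existsP[x /existsP[y /existsP[z]]]|noz] := boolP [exists x, exists y,
    exists z, [&& x \in P, y \in P, x != y, z \notin P, e z x & e z y]].
  move=> /and5P[xP yP xy zP /andP[zx zy]]; right.
  have [P3 Pclique] := Ptri.
  have /eqP/cards1P[d defd] : #|P :\ x :\ y| = 1.
    move: P3; rewrite (cardsD1 x) xP (cardsD1 y (P :\ x)) in_setD1.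
    by rewrite yP eq_sym xy !add1n => -[->].
  have dE t : (t == d) = [&& t != y, t != x & t \in P].
    by have /setP/(_ t) := defd; rewrite in_setD1 in_setD1 in_set1 => <-.
  have /and3P[dy dx dP] : [&& d != y, d != x & d \in P] by rewrite -dE.
  have Dv : diamond (z |: P).
    exists z, x, y, d; split.
    - move=> t; rewrite in_setU1 !in_cons in_nil orbF dE; case: (t == z) => //=.
      have [->|_] := eqVneq t x; rewrite ?xP //=.
      by have [->|_] := eqVneq t y; rewrite ?yP.
    - rewrite /= !inE !negb_or xy (eq_sym x) dx (eq_sym y) dy !andbT.
      by apply/and3P; split; apply: contraNneq zP => ->.
    - by split=> //; apply: Pclique; rewrite // eq_sym.
  by rewrite (block_diamond Dv) // in_setU1 vP orbT.
left; rewrite (block_triangle Ptri) // => x y z xP yP xy zP zx.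
apply: contraNN noz => zy; apply/existsP; exists x; apply/existsP; exists y.
by apply/existsP; exists z; rewrite xP yP xy zP zx.
Qed.

Lemma exists_block_partition : exists Ps : {set {set T}},
  partition Ps [set: T] /\ forall P, P \in Ps -> triangle P \/ diamond P.
Proof.
have tsym := sym_connect_sym tri_adj_sym.
exists (equivalence_partition (connect tri_adj) [set: T]); split.
  apply: equivalence_partitionP => x y z _ _ _; split; first exact: connect0.
  by move=> xy; rewrite (same_connect tsym xy).
move=> _ /imsetP[v _ ->]; have := block_cases v.
suff -> : block v = [set y in [set: T] | connect tri_adj v y] by [].
by apply/setP => u; rewrite !inE.
Qed.

Definition outside P v : nat := #|nbrs v :\: P|.

Lemma outsideE P v : outside P v = 3 - #|nbrs v :&: P|.
Proof. by rewrite /outside cardsD card_nbrs. Qed.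

Lemma outside_triangle P v : triangle P -> v \in P -> outside P v = 1.
Proof.
move=> [P3 Pclique] vP; rewrite outsideE.
suff -> : nbrs v :&: P = P :\ v.
  by move: P3; rewrite (cardsD1 v) vP add1n => -[->].
apply/setP => u; rewrite !inE; case: (boolP (u \in P)) => uP; rewrite ?andbF //.
rewrite !andbT; have [->|uv] := eqVneq u v; first exact: e_irr.
by apply: Pclique; rewrite // eq_sym.
Qed.

Lemma outside_diamond P a b c d : is_diamond P a b c d ->
  [/\ outside P a = ~~ e a d, outside P b = 0,
      outside P c = 0 & outside P d = ~~ e a d].
Proof.
move=> Pd; have [_ _ [ab ac bc bd cd]] := Pd.
have inP v : #|nbrs v :&: P| = e v a + e v b + e v c + e v d.
  rewrite -(sum_diamond (fun x => e v x : nat) Pd) -sum1_card.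
  rewrite big_mkcond [RHS]big_mkcond; apply: eq_bigr => u _.
  by rewrite !inE; case: (u \in P); case: (e v u).
rewrite !outsideE !inP !e_irr ![e b a]e_sym ![e c a]e_sym ![e d _]e_sym.
by rewrite [e c b]e_sym ab ac bc bd cd; case: (e a d).
Qed.


(** * Matchings inside a block *)

(** The sets of edges inside P that cover exactly the vertices of P in U, each
of them once. *)
Definition block_matchings P U : {set {set {set T}}} :=
  [set m : {set {set T}} | [&& m \subset edges e, [forall A in m, A \subset P]
     & [forall v in P, #|incident m v| == (v \in U)]]].

Lemma block_matchingsP P U m : reflect
  [/\ m \subset edges e, forall A, A \in m -> A \subset P
     & forall v, v \in P -> #|incident m v| = (v \in U)]
  (m \in block_matchings P U).
Proof.
rewrite inE; apply: (iffP and3P) => -[mE mP mU]; split=> //.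
- exact/forall_inP.
- by move=> v vP; apply/eqP; move: v vP; apply/forall_inP.
- exact/forall_inP.
- by apply/forall_inP => v /mU ->.
Qed.

Lemma block_matching0 P U : P :&: U = set0 -> set0 \in block_matchings P U.
Proof.
move=> PU0; apply/block_matchingsP; split=> [|A|v vP]; rewrite ?sub0set ?inE //.
have /setP/(_ v) := PU0; rewrite !inE vP /= => ->.
by apply: eq_card0 => A; rewrite !inE.
Qed.

Lemma block_matching1 P U x y :
  e x y -> P :&: U = [set x; y] -> [set [set x; y]] \in block_matchings P U.
Proof.
move=> xy PUxy; apply/block_matchingsP; split=> [|A|v vP].
- by rewrite sub1set mem_edges.
- by rewrite inE => /eqP->; rewrite -PUxy subsetIl.
rewrite /incident setIdE; have -> : (v \in U) = (v \in [set x; y]).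
  by rewrite -PUxy inE vP.
by case: (boolP (v \in [set x; y])) => v2; [apply/eqP/cards1P; exists [set x; y]
   | apply: eq_card0 => A; rewrite !inE]; [apply/setP=> A; rewrite !inE|];
  case: eqP => //= ->; rewrite ?v2 // (negPf v2).
Qed.

Lemma block_matching2 P U x y z t : P \subset U -> e x y -> e z t ->
    P =i [:: x; y; z; t] -> uniq [:: x; y; z; t] ->
  [set [set x; y]; [set z; t]] \in block_matchings P U.
Proof.
move=> /subsetP PU xy zt PE xyzt; rewrite /= !inE !negb_or in xyzt.
have /and4P[/and3P[nxy nxz nxt] /andP[nyz nyt] nzt _] := xyzt.
have disj : [set x; y] != [set z; t].
  by apply: contraNneq nxz => /setP/(_ x); rewrite !inE eqxx (negPf nxt) orbF.
apply/block_matchingsP; split=> [|A|v vP].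
- by apply/subsetP => A; rewrite !inE => /orP[]/eqP->; rewrite mem_edges.
- by rewrite !inE => /orP[]/eqP->; apply/subsetP => v;
    rewrite PE !inE => /orP[]->; rewrite ?orbT.
rewrite /incident setIdE card_set2I // !inE PU //.
move: vP; rewrite PE !inE => /or4P[]/eqP->; rewrite !eqxx ?orbT.
- by rewrite (negPf nxz) (negPf nxt).
- by rewrite (negPf nyz) (negPf nyt).
- by rewrite eq_sym (negPf nxz) eq_sym (negPf nyz).
- by rewrite eq_sym (negPf nxt) eq_sym (negPf nyt).
Qed.

Lemma block_matchings_triangle P U : triangle P -> ~~ odd #|P :&: U| ->
  0 < #|block_matchings P U|.
Proof.
move=> [P3 Pclique] evU; apply/card_gt0P.
have le3 : #|P :&: U| <= 3 by rewrite -P3 subset_leq_card ?subsetIl.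
have [/cards0_eq U0|U2] : #|P :&: U| = 0 \/ #|P :&: U| = 2.
- by move: evU le3; case: #|_| => [|[|[|[|]]]] //; auto.
- by exists set0; apply: block_matching0.
have /eqP/cards2P[x [y [xy PUxy]]] := U2.
have /setIP[xP _] : x \in P :&: U by rewrite PUxy set21.
have /setIP[yP _] : y \in P :&: U by rewrite PUxy set22.
by exists [set [set x; y]]; apply: block_matching1; rewrite // Pclique.
Qed.

(** If all of P is to be covered, then {ab, cd} and {ac, bd} are two choices;
by parity the only other case is that exactly b and c are to be covered. *)
Lemma block_matchings_diamond P U a b c d : is_diamond P a b c d ->
    b \in U -> c \in U -> ~~ odd #|P :&: U| ->
  2 ^ (P \subset U) <= #|block_matchings P U|.
Proof.
move=> Pd bU cU evU; have [PE abcd [ab ac bc bd cd]] := Pd.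
have aUd : (a \in U) = (d \in U).
  have cardPU : #|P :&: U| = (a \in U) + 2 + (d \in U).
    transitivity (\sum_(u in P) (u \in U)); last first.
      by rewrite (sum_diamond _ Pd) bU cU -!addnA.
    rewrite -sum1_card big_mkcond [RHS]big_mkcond; apply: eq_bigr => u _.
    by rewrite inE; case: (u \in P); case: (u \in U).
  by move: evU; rewrite cardPU; case: (a \in U); case: (d \in U).
case: (boolP (P \subset U)) => [PU|nPU].
  set m1 := [set [set a; b]; [set c; d]].
  set m2 := [set [set a; c]; [set b; d]].
  have m12 : m1 != m2.
    move: abcd; rewrite /= !inE !negb_or.
    move=> /and4P[/and3P[nab _ nad] /andP[nbc _] _ _].
    apply/eqP => /setP/(_ [set a; b]); rewrite !inE eqxx /= => /esym/orP[]/eqP.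
      by move/set2_inj_r/eqP; rewrite (negPf nbc).
    by move/setP/(_ a); rewrite !inE eqxx (negPf nab) (negPf nad).
  have -> : 2 ^ true = #|[set m1; m2]| by rewrite cards2 m12.
  apply/subset_leq_card/subsetP => m; rewrite in_set2 => /orP[]/eqP->.
    by apply: block_matching2.
  apply: block_matching2 => // [x|].
    by rewrite PE !inE; congr (_ || _); rewrite orbCA.
  rewrite (perm_uniq (_ : perm_eq _ [:: a; b; c; d])) // perm_cons.
  by rewrite (perm_catCA [:: c] [:: b] [:: d]).
apply/card_gt0P; exists [set [set b; c]]; apply: block_matching1 => //.
have aU : a \notin U.
  apply: contra nPU => aU; apply/subsetP => x; rewrite PE !inE.
  by case/or4P=> /eqP->; rewrite // -aUd.
apply/setP => x; rewrite inE PE !inE.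
have [-> |_] := eqVneq x b; first by rewrite bU orbT.
have [-> |_] := eqVneq x c; first by rewrite cU !orbT.
rewrite orbF /=; apply/negP => /andP[/orP[]/eqP->].
  exact/negP.
by rewrite -aUd; apply/negP.
Qed.

(** * Edges between blocks *)

Variable Ps : {set {set T}}.
Hypothesis Ps_partition : partition Ps [set: T].
Hypothesis Ps_cases : forall P, P \in Ps -> triangle P \/ diamond P.

Definition between_blocks : {set {set T}} :=
  [set A in edges e | [forall P in Ps, ~~ (A \subset P)]].

Local Notation B := between_blocks.

Definition cut P : {set {set T}} := [set A in edges e | #|A :&: P| == 1].

Lemma B_edges : B \subset edges e.
Proof. by apply/subsetP => A; rewrite inE => /andP[]. Qed.

Lemma between_blocksN A P : A \in B -> P \in Ps -> ~~ (A \subset P).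
Proof. by rewrite inE => /andP[_ /forall_inP]; apply. Qed.

Lemma same_block P Q v : P \in Ps -> Q \in Ps -> v \in P -> v \in Q -> P = Q.
Proof.
have [_ tI _] := and3P Ps_partition.
by move=> PP QP vP vQ; rewrite -(def_pblock tI PP vP) (def_pblock tI QP vQ).
Qed.

Lemma exists_block v : exists2 P, P \in Ps & v \in P.
Proof.
have [/eqP covT _ _] := and3P Ps_partition.
have : v \in cover Ps by rewrite covT.
by case/bigcupP => P; exists P.
Qed.

Lemma card_edge A : A \in edges e -> #|A| = 2.
Proof. by case/edgesP=> x [y [/adj_neq xy ->]]; rewrite cards2 xy. Qed.

Lemma edge_subset A P : A \in edges e -> (A \subset P) = (#|A :&: P| == 2).
Proof.
move=> AE; rewrite -{1}(card_edge AE);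
apply/idP/idP => [/setIidPl ->//|/eqP cAP].
by apply/setIidPl/eqP; rewrite eqEcard subsetIl cAP leqnn.
Qed.

Lemma cut_subset P : P \in Ps -> cut P \subset B.
Proof.
move=> PP; apply/subsetP => A; rewrite !inE => /andP[AE A1]; rewrite AE /=.
apply/forall_inP => Q QP; apply/negP => AQ.
have /card_gt0P[x /setIP[xA xP]] : 0 < #|A :&: P| by rewrite (eqP A1).
have PQ := same_block PP QP xP (subsetP AQ x xA).
by move: AQ; rewrite -PQ edge_subset // (eqP A1).
Qed.

Lemma card_edge_cut A P : A \in B -> P \in Ps -> #|A :&: P| = (A \in cut P).
Proof.
move=> AB PP; have AE := subsetP B_edges A AB.
have := between_blocksN AB PP; rewrite [A \in cut P]inE AE.
by rewrite edge_subset //=; have := card_edgeI P AE; case: #|_| => [|[|[|]]].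
Qed.

Lemma between_blocks_at P u v : P \in Ps -> v \in P ->
  ([set v; u] \in B) = (u \in nbrs v :\: P).
Proof.
move=> PP vP; rewrite !inE mem_edges andbC; congr (_ && _).
apply/forall_inP/idP => [/(_ P PP)|uP Q QP].
  by apply: contraNN => uP; apply/subsetP => x; rewrite !inE => /orP[]/eqP->.
apply: contraNN uP => /subsetP vuQ.
by rewrite (same_block PP QP vP) vuQ // ?set21 ?set22.
Qed.

Lemma card_incident_between P v : P \in Ps -> v \in P ->
  #|incident B v| = outside P v.
Proof.
move=> PP vP; rewrite card_incident ?B_edges //; apply: eq_card => u.
by rewrite inE (between_blocks_at _ PP).
Qed.

Lemma outside_le1 P v : P \in Ps -> v \in P -> outside P v <= 1.
Proof.
move=> PP vP; case: (Ps_cases PP) => [Pt|[a [b [c [d Pd]]]]].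
  by rewrite outside_triangle.
have [oa ob oc od] := outside_diamond Pd.
have [PE _ _] := Pd; move: vP; rewrite PE !inE.
by case/or4P => /eqP->; rewrite ?oa ?ob ?oc ?od //; case: (e a d).
Qed.

Lemma card_incident_cover J v : J \subset B ->
  #|incident J v| = (v \in cover J).
Proof.
move=> JB; have [P PP vP] := exists_block v.
have : #|incident J v| <= 1.
  apply: leq_trans (outside_le1 PP vP); rewrite -card_incident_between //.
  apply/subset_leq_card/subsetP => A.
  by case/setIdP => /(subsetP JB) AB vA; apply/setIdP.
case: (boolP (v \in cover J)) => [/bigcupP[A AJ vA]|nvJ].
  have : 0 < #|incident J v| by apply/card_gt0P; exists A; rewrite inE AJ.
  by case: #|_| => [|[|]].
move=> _; apply: eq_card0 => A; rewrite !inE; apply/negP => /andP[AJ vA].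
by case/bigcupP: nvJ; exists A.
Qed.

Lemma sum_incident P J :
  \sum_(v in P) #|incident J v| = \sum_(A in J) #|A :&: P|.
Proof.
transitivity (\sum_(v in P) \sum_(A in J) (v \in A)).
  apply: eq_bigr => v _; rewrite -sum1_card big_mkcond [RHS]big_mkcond.
  by apply: eq_bigr => A _; rewrite !inE; case: (A \in J); case: (v \in A).
rewrite exchange_big; apply: eq_bigr => A _.
rewrite -sum1_card big_mkcond [RHS]big_mkcond.
by apply: eq_bigr => v _; rewrite !inE; case: (v \in P); case: (v \in A).
Qed.

Lemma sum_incident_cut J P : J \subset B -> P \in Ps ->
  \sum_(v in P) #|incident J v| = #|J :&: cut P|.
Proof.
move=> /subsetP JB PP; rewrite sum_incident -sum1_card.
rewrite big_mkcond [RHS]big_mkcond; apply: eq_bigr => A _; rewrite in_setI.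
by case: (boolP (A \in J)) => [/JB AB|//];
  rewrite card_edge_cut //; case: (A \in cut P).
Qed.

Lemma card_cover_cut J P : J \subset B -> P \in Ps ->
  #|P :&: cover J| = #|J :&: cut P|.
Proof.
move=> JB PP; rewrite -sum_incident_cut // -sum1_card.
rewrite big_mkcond [RHS]big_mkcond; apply: eq_bigr => v _; rewrite in_setI.
by rewrite card_incident_cover //; case: (v \in P); case: (v \in cover J).
Qed.

Lemma card_cut_outside P : P \in Ps -> #|cut P| = \sum_(v in P) outside P v.
Proof.
move=> PP; rewrite -(setIidPr (cut_subset PP)) -sum_incident_cut //.
by apply: eq_bigr => v vP; rewrite (card_incident_between PP).
Qed.

Lemma card_diamond P : diamond P -> #|P| = 4.
Proof.
by move=> [a [b [c [d Pd]]]]; rewrite -sum1_card (sum_diamond _ Pd).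
Qed.

(** In a triangle each vertex has one neighbour outside; in a diamond only a
and d can have one, and they do so both or neither according to whether a and d
are adjacent. *)
Lemma card_cut P : P \in Ps -> #|cut P| = (cut P != set0) * 2 + (#|P| == 3).
Proof.
move=> PP; rewrite -card_gt0 card_cut_outside //.
case: (Ps_cases PP) => [Pt|Pd].
  rewrite (eq_bigr (fun=> 1)) => [|v vP]; last by rewrite outside_triangle.
  by rewrite sum1_card; case: Pt => ->.
rewrite (card_diamond Pd); case: Pd => a [b [c [d Pd]]].
rewrite (sum_diamond _ Pd); have [-> -> -> ->] := outside_diamond Pd.
by case: (e a d).
Qed.

Lemma odd_cut P : P \in Ps -> odd #|cut P| = odd #|P|.
Proof.
move=> PP; rewrite card_cut // muln2 oddD odd_double /=.
by case: (Ps_cases PP) => [[->]|/card_diamond ->].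
Qed.

(** Each edge between blocks lies in two cuts. *)
Lemma card_between_blocks :
  2 * #|B| =
    2 * #|[set P in Ps | cut P != set0]| + #|[set P in Ps | #|P| == 3]|.
Proof.
transitivity (\sum_(P in Ps) #|cut P|).
  rewrite (eq_bigr (fun P => \sum_(v in P) #|incident B v|)); last first.
    by move=> P PP; rewrite sum_incident_cut // (setIidPr (cut_subset PP)).
  rewrite -(set_partition_big _ Ps_partition) sum_incident.
  rewrite (eq_bigr (fun=> 2)) => [|A AB]; first by rewrite sum_nat_const mulnC.
  by rewrite setIT card_edge // (subsetP B_edges).
rewrite (eq_bigr _ card_cut) big_split /= -big_distrl mulnC /=.
by congr (_ * _ + _); rewrite -sum1_card big_mkcond [RHS]big_mkcond;
  apply: eq_bigr => P _; rewrite inE; case: (P \in Ps) => //=; case: (_ == _).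
Qed.

(** * Extending an even set to perfect matchings *)

Local Notation X := (even_sets cut B Ps).
(* The vertices left to be matched inside their blocks when a matching has
   exactly the edges of B outside C between the blocks. *)
Local Notation unmatched C := (~: cover (B :\: C)).

Lemma even_unmatched C P : C \in X -> P \in Ps -> ~~ odd #|P :&: unmatched C|.
Proof.
case/even_setsP => CB evC PP.
have evP : ~~ odd #|cut P :&: C| by rewrite setIC; apply: evC.
have JB : B :\: C \subset B by apply: subsetDl.
have JcutE : (B :\: C) :&: cut P = cut P :\: C.
  by rewrite setIDAC (setIidPr (cut_subset PP)).
have sumP := cardsID (cover (B :\: C)) P.
rewrite [P :\: _]setDE card_cover_cut // JcutE in sumP.
have := odd_cut PP; rewrite -sumP -(cardsID C (cut P)) !oddD.
rewrite (negPf evP).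
by case: (odd _); case: (odd _).
Qed.

Lemma unmatched_block C P :
  P \in Ps -> cut P \subset C -> P \subset unmatched C.
Proof.
move=> PP /subsetP cC; apply/subsetP => v vP.
rewrite inE; apply/bigcupP => -[A].
rewrite inE => /andP[nAC AB] vA; case/negP: nAC; apply: cC.
have := card_edge_cut AB PP; case: (A \in cut P) => // /cards0_eq /setP/(_ v).
by rewrite !inE vA vP.
Qed.

Lemma unmatched_outside0 C P v :
  P \in Ps -> v \in P -> outside P v = 0 -> v \in unmatched C.
Proof.
move=> PP vP; rewrite -(card_incident_between PP) // => /cards0_eq /setP v0.
rewrite inE; apply/bigcupP => -[A]; rewrite inE => /andP[_ AB] vA.
by have := v0 A; rewrite in_set0 inE AB vA.
Qed.

(** The diamonds from which a matching avoiding C has no edge leaving, so that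
they are matched within themselves.  Blocks have three or four vertices, and
those with four are the diamonds. *)
Definition free_diamonds C : {set {set T}} :=
  [set P in Ps | (#|P| == 4) && (cut P \subset C)].

Lemma block_matchings_ge C P : C \in X -> P \in Ps ->
  2 ^ (P \in free_diamonds C) <= #|block_matchings P (unmatched C)|.
Proof.
move=> CX PP; have evU := even_unmatched CX PP; rewrite inE PP /=.
case: (Ps_cases PP) => [Pt|Pd].
  have := block_matchings_triangle Pt evU.
  by case: Pt => ->.
rewrite (card_diamond Pd) /=; case: Pd => a [b [c [d Pd]]].
have [_ ob oc _] := outside_diamond Pd; have [PE _ _] := Pd.
have bU : b \in unmatched C.
  by apply: (unmatched_outside0 C PP _ ob); rewrite PE !inE eqxx orbT.
have cU : c \in unmatched C.
  by apply: (unmatched_outside0 C PP _ oc); rewrite PE !inE eqxx !orbT.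
apply: leq_trans (block_matchings_diamond Pd bU cU evU).
rewrite leq_exp2l //; have := @unmatched_block C P PP.
by case: (cut P \subset C) => // ->.
Qed.

Definition extensions C : {set {set {set T}}} :=
  [set M in perfect_matchings e | B :\: M == C].

Definition glue C (f : {ffun {set T} -> {set {set T}}}) : {set {set T}} :=
  (B :\: C) :|: \bigcup_(P in Ps) f P.

(** The matchings inside the blocks can be chosen independently, and can be
recovered from the glued matching as its edges inside each block. *)
Lemma card_extensions_ge C : C \in X ->
  \prod_(P in Ps) #|block_matchings P (unmatched C)| <= #|extensions C|.
Proof.
case/even_setsP => CB _; have JB : B :\: C \subset B by apply: subsetDl.
under eq_bigr do rewrite -sum1_card.
(* The product of the cardinals counts the families f of block matchings, with
   the default value set0 outside Ps. *)
rewrite (big_distr_big_dep set0) /=.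
rewrite (eq_bigr (fun=> 1)) => [|f _]; last by rewrite big1.
rewrite sum1_card.
set F := pfamily _ _ _.
have inF f P : f \in F -> P \in Ps -> f P \in block_matchings P (unmatched C).
  by move=> /pfamilyP[_ fF] /fF.
have notB f P A : f \in F -> P \in Ps -> A \in f P -> A \notin B.
  move=> fF PP AfP.
  have [_ /(_ A AfP) AP _] := block_matchingsP _ _ _ (inF f P fF PP).
  by apply/negP => AB; have := between_blocksN AB PP; rewrite AP.
have block_of f P :
    f \in F -> P \in Ps -> [set A in glue C f | A \subset P] = f P.
  move=> fF PP; apply/setP => A; rewrite inE in_setU.
  have [fE fsub _] := block_matchingsP _ _ _ (inF f P fF PP).
  apply/andP/idP => [[/orP[/(subsetP JB) AB|/bigcupP[Q QP AQ]] AP]|AfP].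
  - by have := between_blocksN AB PP; rewrite AP.
  - have [QE Qsub _] := block_matchingsP _ _ _ (inF f Q fF QP).
    have /card_gt0P[x xA] : 0 < #|A| by rewrite card_edge // (subsetP QE).
    by rewrite (same_block PP QP (subsetP AP x xA) (subsetP (Qsub A AQ) x xA)).
  - by split; [apply/orP; right; apply/bigcupP; exists P|apply: fsub].
have injF : {in F &, injective (glue C)}.
  move=> f g fF gF eqfg; apply/ffunP => P.
  have [PP|nPP] := boolP (P \in Ps).
    by rewrite -(block_of f) // -(block_of g) // eqfg.
  have supp0 h : h \in F -> h P = set0.
    case/pfamilyP => /supportP hP _; exact: hP.
  by rewrite !supp0.
rewrite -(card_in_imset injF).
apply/subset_leq_card/subsetP => _ /imsetP[f fF ->].
have glueB A : A \in B -> (A \in glue C f) = (A \notin C).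
  move=> AB; rewrite in_setU in_setD AB andbT.
  apply/orb_idr => /bigcupP[P PP AfP].
  by have := notB f P A fF PP AfP; rewrite AB.
rewrite inE; apply/andP; split; last first.
  apply/eqP/setP => A; rewrite in_setD; case: (boolP (A \in B)) => AB.
    by rewrite glueB // negbK andbT.
  by rewrite andbF; apply/esym; apply: contraNF AB => /(subsetP CB).
rewrite inE; apply/andP; split.
  apply/subsetP => A.
  rewrite in_setU => /orP[/(subsetP JB)/(subsetP B_edges)//|].
  case/bigcupP => P PP; apply/subsetP.
  by have [] := block_matchingsP _ _ _ (inF f P fF PP).
apply/forallP => v; have [P PP vP] := exists_block v.
have [_ fsub fU] := block_matchingsP _ _ _ (inF f P fF PP).
have -> : incident (glue C f) v = incident (B :\: C) v :|: incident (f P) v.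
  apply/setP => A.
  rewrite in_setU ![A \in incident _ _]in_set [A \in glue C f]in_setU.
  case vA: (v \in A); rewrite ?andbF // !andbT; congr (_ || _).
  apply/bigcupP/idP => [[Q QP AQ]|AP]; last by exists P.
  have [_ Qsub _] := block_matchingsP _ _ _ (inF f Q fF QP).
  by rewrite (same_block PP QP vP (subsetP (Qsub A AQ) v vA)).
have disj : [disjoint incident (B :\: C) v & incident (f P) v].
  rewrite -setI_eq0; apply/eqP/setP => A.
  rewrite in_setI in_set0 ![A \in incident _ _]in_set.
  apply/negP => /andP[/andP[/(subsetP JB) AB _] /andP[AfP _]].
  by have := notB f P A fF PP AfP; rewrite AB.
move: disj; rewrite -leq_card_setU => /eqP ->.
by rewrite card_incident_cover // fU // inE; case: (v \in cover _).
Qed.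

Lemma sum_free_diamonds_le :
  \sum_(C in X) 2 ^ #|free_diamonds C| <= #|perfect_matchings e|.
Proof.
apply: (@leq_trans (\sum_(C in X) #|extensions C|)).
  apply: leq_sum => C CX; apply: leq_trans (card_extensions_ge CX).
  rewrite -sum1_card (big_morph _ (expnD 2) (erefl : 2 ^ 0 = 1)).
  rewrite (big_mkcond _ (fun=> 2 ^ 1)) /=.
  rewrite -(setIidPr (_ : free_diamonds C \subset Ps)).
    rewrite [X in _ <= X]big_mkcond; apply: leq_prod => P _.
    rewrite in_setI; case: (boolP (P \in Ps)) => //= PP.
    by have := block_matchings_ge CX PP; case: (P \in free_diamonds C).
  by apply/subsetP => P; rewrite inE => /andP[].
rewrite -[X in _ <= X]sum1_card.
rewrite [X in _ <= X](bigID (fun M => B :\: M \in X)) /=.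
apply: leq_trans (leq_addr _ _).
rewrite [leqRHS](partition_big (fun M => B :\: M) (mem X)) /=; last first.
  by move=> M /andP[].
apply: leq_sum => C CX; rewrite -sum1_card; apply: eq_leq; apply: eq_bigl => M.
rewrite [M \in extensions C]inE.
by case: eqP => [->|]; rewrite ?andbF // CX !andbT.
Qed.

(** * The number of perfect matchings *)

Hypothesis e_no_cutedge : forall A, ~ cutedge e A.

Lemma edge_cut x y P :
  e x y -> ([set x; y] \in cut P) = (x \in P) (+) (y \in P).
Proof.
move=> xy; rewrite inE mem_edges xy card_set2I ?adj_neq //=.
by case: (x \in P); case: (y \in P).
Qed.

(** The set C consists of the edges between blocks that the walk uses an odd
number of times: the walk crosses the boundary of P an odd number of times if
and only if exactly one of its ends is in P. *)
Lemma walk_cut A x p : path (delete_edge e A) x p ->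
  exists C, [/\ C \subset B, A \notin C
    & forall P, P \in Ps ->
        odd #|C :&: cut P| = (x \in P) (+) (last x p \in P)].
Proof.
elim: p x => [|z p IHp] x /=.
  move=> _; exists set0; split=> [||P _]; rewrite ?sub0set ?inE //.
  by rewrite set0I cards0 addbb.
case/andP => /andP[xz nA] /IHp[C [CB AC oddC]].
exists (symd ([set [set x; z]] :&: B) C); split=> [||P PP].
- by rewrite symd_subset ?subsetIr.
- by rewrite inE (negPf AC) addbF in_setI in_set1 eq_sym (negPf nA).
rewrite odd_symd oddC // -setIA (setIidPr (cut_subset PP)).
have -> : odd #|[set [set x; z]] :&: cut P| = ([set x; z] \in cut P).
  case: (boolP ([set x; z] \in cut P)) => xzP.
    by rewrite (setIidPl _) ?sub1set // cards1.
  have /eqP -> : [set [set x; z]] :&: cut P == set0.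
    by rewrite setI_eq0 disjoints1.
  by rewrite cards0.
by rewrite edge_cut // addbA -[_ (+) _ (+) (z \in P)]addbA addbb addbF.
Qed.

(** Close a walk between the ends of A that avoids A by the edge A. *)
Lemma exists_even_set_through A : A \in B -> exists2 C, C \in X & A \in C.
Proof.
move=> AB; have /edgesP[x [y [xy defA]]] := subsetP B_edges A AB.
have := connect_delete xy (@e_no_cutedge _); rewrite -defA.
case/connectP => p /walk_cut[C [CB AC oddC]] defy.
exists (symd [set A] C); last by rewrite inE set11 (negPf AC).
apply/even_setsP; split=> [|P PP]; first by rewrite symd_subset ?sub1set.
rewrite odd_symd oddC // -defy.
have -> : odd #|[set A] :&: cut P| = (A \in cut P).
  case: (boolP (A \in cut P)) => AP.
    by rewrite (setIidPl _) ?sub1set // cards1.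
  have /eqP -> : [set A] :&: cut P == set0 by rewrite setI_eq0 disjoints1.
  by rewrite cards0.
by rewrite defA edge_cut // addbb.
Qed.

(** The cut of a diamond is empty or has two edges.  An even set that contains
one of these contains both, and half of the even sets contain it. *)
Lemma card_free_ge P : P \in Ps -> #|P| == 4 ->
  #|X| <= 2 * #|[set C in X | P \in free_diamonds C]|.
Proof.
move=> PP P4; have := card_cut PP; rewrite (eqP P4) addn0.
have [cut0 _|[A Ac]] := set_0Vmem (cut P).
  have -> : [set C in X | P \in free_diamonds C] = X.
    apply/setP => C; rewrite in_set; apply: andb_idr => _.
    by rewrite inE PP P4 cut0 sub0set.
  by rewrite mul2n -addnn leq_addr.
have -> /= : cut P != set0 by apply/set0Pn; exists A.
move=> cut2; have AB := subsetP (cut_subset PP) A Ac.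
have [C0 C0X AC0] := exists_even_set_through AB.
rewrite -(card_even_sets_mem C0X AC0) leq_mul2l /=.
apply/subset_leq_card/subsetP => C /setIdP[CX AC].
apply/setIdP; split=> //; rewrite inE PP P4 /=.
case/even_setsP: CX => _ /(_ P PP) evC.
apply/setIidPr/eqP; rewrite eqEcard subsetIr cut2.
have : 0 < #|C :&: cut P| by apply/card_gt0P; exists A; rewrite inE AC.
by move: evC; case: #|_| => [|[|]].
Qed.

(** In the square, the t triangles contribute a factor 2 ^ t through the number
of even sets, and the q diamonds a factor 2 ^ q through the choices left in the
free ones. *)
Lemma card_perfect_matchings_sqr :
  2 ^ #|Ps| <= #|perfect_matchings e| ^ 2.
Proof.
set q := #|[set P in Ps | #|P| == 4]|; set t := #|[set P in Ps | #|P| == 3]|.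
have tq : #|Ps| = t + q.
  rewrite -(cardsID [set P : {set T} | #|P| == 3] Ps); congr (_ + _).
    by apply: eq_card => P; rewrite !inE.
  apply: eq_card => P; rewrite !inE andbC; case: (boolP (P \in Ps)) => //= PP.
  by case: (Ps_cases PP) => [[->]|/card_diamond ->].
have avg : #|X| * q <= 2 * \sum_(C in X) #|free_diamonds C|.
  have -> : \sum_(C in X) #|free_diamonds C| =
      \sum_(P in [set P in Ps | #|P| == 4])
        #|[set C in X | P \in free_diamonds C]|.
    under eq_bigr do rewrite -sum1_card big_mkcond.
    rewrite exchange_big /= [RHS]big_mkcond; apply: eq_bigr => P _.
    case: (boolP (P \in [set P in Ps | #|P| == 4])) => PP.
      rewrite -sum1_card -big_mkcondr; apply: eq_bigl => C.
      by rewrite [RHS]inE.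
    rewrite big1 // => C _; case: ifP => // PC; case/negP: PP.
    by move: PC; rewrite !inE andbA => /andP[].
  rewrite big_distrr /= mulnC -sum_nat_const; apply: leq_sum => P.
  by rewrite inE => /andP[]; apply: card_free_ge.
have Xsqr : 2 ^ t <= #|X| ^ 2.
  have := card_even_sets_ge cut B Ps; have := card_between_blocks.
  rewrite -/t; set s := #|[set P in Ps | cut P != set0]| => Bst.
  rewrite -(leq_exp2r _ _ (isT : 0 < 2)) expnMn -!expnM mulnC Bst expnD mulnC.
  by rewrite [s * 2]mulnC leq_pmul2r // expn_gt0.
have := sum_exp2_ge avg; rewrite tq expnD => le_sum.
apply: leq_trans (leq_mul Xsqr (leqnn _)) _; apply: leq_trans le_sum _.
by rewrite leq_exp2r // sum_free_diamonds_le.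
Qed.

Lemma card_vertices_le : #|T| <= 4 * #|Ps|.
Proof.
rewrite -cardsT (card_partition Ps_partition) mulnC -sum_nat_const.
by apply: leq_sum => P PP; case: (Ps_cases PP) => [[->]|/card_diamond ->].
Qed.

End Graph.

Import Order.TTheory GRing.Theory Num.Theory.
Local Open Scope ring_scope.

Theorem theorem2 (R : realType) (T : finType) (e : rel T)
    (e_sym : symmetric e) (e_irr : irreflexive e) (T_nonempty : (0 < #|T|)%N)
    (e_claw_free : claw_free e) (e_cubic : cubic e)
    (e_no_cutedge : forall A : {set T}, ~ cutedge e A) :
  (2 : R) `^ (#|T|%:R / 12%:R) < #|perfect_matchings e|%:R.
Proof.
(* With k blocks, n <= 4 k and 2 ^ k <= #PM ^ 2, so that
   2 ^ n < 2 ^ (6 k) <= #PM ^ 12. *)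
have [Ps [Ps_part Ps_cases]] :=
  exists_block_partition e_sym e_irr e_claw_free e_cubic.
have pm_sqr := card_perfect_matchings_sqr e_sym e_irr e_cubic Ps_part
  Ps_cases e_no_cutedge.
have T_le := card_vertices_le Ps_part Ps_cases.
have pm_pow : (2 ^ #|T| < #|perfect_matchings e| ^ 12)%N.
  apply: (@leq_trans (2 ^ (#|Ps| * 6))); first by rewrite ltn_exp2l //; lia.
  by rewrite expnM -[12%N]/(2 * 6)%N expnM leq_exp2r.
rewrite -(@ltr_pXn2r _ 12) ?nnegrE ?powR_ge0 ?ler0n //.
rewrite -powR_mulrn ?powR_ge0 // -powRrM divfK ?pnatr_eq0 //.
by rewrite powR_mulrn ?ler0n // -!natrX ltr_nat.
Qed.
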